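(* Let $K$ be a field, $S=K[x_1,\ldots,x_n]$, and let $I\subset S$ be a monomial ideal with $\dim S/I=0$. Let $\mathcal{S}$ be the set of variables of $S^\wp$, and let $\Delta(I)$ be the simplicial complex with Stanley--Reisner ideal $I^\wp$. Then $F\subset\mathcal{S}$ is a facet of $\Delta(I)$ if and only if there exists a monomial $x_1^{a_1}\cdots x_n^{a_n}\in\operatorname{Mon}(S\setminus I)$ such that $$F=\mathcal{S}\setminus\{x_{1,a_1+1},\ldots,x_{n,a_n+1}\}.$$
   Context: $\operatorname{Mon}(S\setminus I)$ is the (finite) set of monomials of $S$ not belonging to $I$. For a monomial ideal $I$, $G(I)$ is its unique minimal set of monomial generators. For $i=1,\ldots,n$ let $b_i\ge 1$ be the smallest integer with $x_i^{b_i}\in I$ (it exists since $\dim S/I=0$). $S^\wp$ is the polynomial ring over $K$ in the variables $x_{i,j}$, $1\le i\le n$, $1\le j\le b_i$. The polarization of a monomial $v=x_1^{c_1}\cdots x_n^{c_n}$ with $c_i\le b_i$ is $v^\wp=\prod_{i=1}^n\prod_{j=1}^{c_i}x_{i,j}$, and the polarization of $I$ is the ideal $I^\wp\subset S^\wp$ generated by the monomials $v^\wp$ with $v\in G(I)$. $\Delta(I)$ is the simplicial complex on the set $\mathcal{S}$ of variables of $S^\wp$ whose faces are the subsets $F\subset\mathcal{S}$ with $\prod_{x\in F}x\notin I^\wp$ (a variable need not itself be a face); facets are the inclusion-maximal faces. *)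

(* Defs.v *)
From HB Require Import structures.
From mathcomp Require Import all_boot all_order all_algebra ring_quotient.
From mathcomp Require Import generic_quotient mpoly boolp.

Set Implicit Arguments.
Unset Strict Implicit.
Unset Printing Implicit Defensive.

Import GRing.Theory.
Local Open Scope ring_scope.

Section CommutativeRings.
Variable R : comNzRingType.

(* Only P 0, ..., P d matter: a chain with d strict inclusions. *)
Definition prime_chain (d : nat) (P : nat -> prime_idealr R) : Prop :=
  forall i, (i < d)%N ->
    {subset P i <= P i.+1} /\ ~ {subset P i.+1 <= P i}.

Definition krull_dim (d : nat) : Prop :=
  (exists P, prime_chain d P) /\
  (forall e P, prime_chain e P -> (e <= d)%N).

Definition ideal_gen (A : R -> Prop) : {pred R} :=
  fun p => `[< exists s : seq (R * R),
    (forall x, x \in s -> A x.2) /\ p = \sum_(x <- s) x.1 * x.2 >].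

End CommutativeRings.

Section MonomialIdeals.
Variables (K : fieldType) (n : nat).
Implicit Types (I : {pred {mpoly K[n]}}) (A B : 'X_{1..n} -> Prop).

Definition mon_generates I A : Prop :=
  I =i ideal_gen (fun q => exists2 m, A m & q = 'X_[m]).

Definition monomial_ideal I : Prop := exists A, mon_generates I A.

Definition min_mon_generates I A : Prop :=
  mon_generates I A /\
  (forall B, (forall m, B m -> A m) -> mon_generates I B ->
     forall m, A m -> B m).

(* The set G(I). By [min_mon_generates_ex] and [min_mon_generates_uniq] there
   is exactly one such A when I is a monomial ideal. *)
Definition mon_gens I : 'X_{1..n} -> Prop :=
  fun m => exists2 A, min_mon_generates I A & A m.

End MonomialIdeals.

Section MinimalGenerators.
Variables (K : fieldType) (n : nat) (I : idealr {mpoly K[n]}).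
Implicit Types (m k : 'X_{1..n}) (A B : 'X_{1..n} -> Prop).

Let divmin m : Prop :=
  'X_[m] \in I /\ forall k, 'X_[k] \in I -> (k <= m)%MM -> k = m.

Let genX A m : mon_generates I A -> A m -> 'X_[m] \in I.
Proof.
move=> genA Am; rewrite genA; apply/asboolP.
exists [:: (1, 'X_[m])]; split; last by rewrite big_seq1 mul1r.
by move=> x; rewrite inE => /eqP ->; exists m.
Qed.

Let gen_dvd A m : mon_generates I A -> 'X_[m] \in I ->
  exists2 k, A k & (k <= m)%MM.
Proof.
move=> genA; rewrite genA => /asboolP[s [sA eqm]].
have : ('X_[m] : {mpoly K[n]})@_m != 0 by rewrite mcoeffX eqxx oner_neq0.
rewrite eqm raddf_sum /= => nz.
have [x xs] : exists2 x, x \in s & (x.1 * x.2)@_m != 0.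
  apply: contrapT => none; move/negP: nz; apply; apply/eqP.
  rewrite big_seq big1 // => x xs; apply/eqP; apply: contrapT => /negP xm.
  by apply: none; exists x.
have [k Ak ->] := sA _ xs; rewrite -mcoeff_msupp (perm_mem (msuppMX _ _)).
move=> /mapP[m' _ ->]; exists k => //.
by apply/mnm_lepP => i; rewrite mnmDE leq_addr.
Qed.

Let divmin_ex m : 'X_[m] \in I -> exists2 k, divmin k & (k <= m)%MM.
Proof.
elim: {m}(mdeg m) {-2}m (leqnn (mdeg m)) => [|d IHd] m le_m mI.
  exists m; last exact: lepm_refl.
  split=> // k _ /mnm_lepP le_km; apply/mnmP => i.
  have m0 : m = 0%MM by apply/eqP; rewrite -mdeg_eq0 -leqn0.
  by apply/eqP; move: (le_km i); rewrite m0 mnm0E leqn0.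
have [mmin|] := pselect (divmin m).
  by exists m => //; exact: lepm_refl.
move=> notmin.
have [k kI [le_km ne_km]] :
    exists2 k, 'X_[k] \in I & (k <= m)%MM /\ k <> m.
  apply: contrapT => none; apply: notmin; split=> // k kI le_km.
  by apply: contrapT => ne_km; apply: none; exists k.
have lt_km : (mdeg k < mdeg m)%N.
  have eqm := submK le_km.
  rewrite -eqm mdegD -[X in (X < _)%N]add0n ltn_add2r lt0n mdeg_eq0.
  by apply/eqP => m0; apply: ne_km; rewrite -eqm m0 add0m.
have [k' k'min le_k'] := IHd k (leq_trans lt_km le_m) kI.
by exists k' => //; exact: lepm_trans le_k' le_km.
Qed.

Let divmin_gen : monomial_ideal I -> mon_generates I divmin.
Proof.
move=> [A genA] p; apply/idP/asboolP; last first.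
  move=> [s [sM ->]]; rewrite big_seq; apply: rpred_sum => x xs.
  by have [m [mI _] ->] := sM _ xs; exact: idealMr.
rewrite genA => /asboolP[s [sA ->]].
have splitx x : exists y : {mpoly K[n]} * {mpoly K[n]}, x \in s ->
    (exists2 m, divmin m & y.2 = 'X_[m]) /\ x.1 * x.2 = y.1 * y.2.
  have [xs|] := boolP (x \in s); last by exists x.
  have [m Am xm] := sA _ xs; have [k kmin le_km] := divmin_ex (genX genA Am).
  exists (x.1 * 'X_[m - k], 'X_[k]) => _; split; first by exists k.
  by rewrite /= xm -mulrA -mpolyXD submK.
have [f fP] := choice splitx; exists (map f s); split.
  by move=> _ /mapP[x xs ->]; exact: (fP _ xs).1.
by rewrite big_map; apply: eq_big_seq => x /fP[].
Qed.

Let divmin_sub A : mon_generates I A -> forall m, divmin m -> A m.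
Proof.
move=> genA m [mI minm]; have [k Ak le_km] := gen_dvd genA mI.
by rewrite -(minm k) //; exact: genX genA Ak.
Qed.

Lemma min_mon_generates_ex :
  monomial_ideal I -> exists A, min_mon_generates I A.
Proof.
move=> monI; exists divmin; split; first exact: divmin_gen.
by move=> B _ genB m; exact: divmin_sub.
Qed.

Lemma min_mon_generates_uniq A B :
  min_mon_generates I A -> min_mon_generates I B -> forall m, A m <-> B m.
Proof.
move=> [genA minA] [genB minB] m.
have genM : mon_generates I divmin by apply: divmin_gen; exists A.
split=> [Am|Bm].
  by apply: (divmin_sub genB); apply: minA Am => //; exact: divmin_sub.
by apply: (divmin_sub genA); apply: minB Bm => //; exact: divmin_sub.
Qed.

End MinimalGenerators.

Section PurePowers.
Variables (K : fieldType) (n : nat) (I : idealr {mpoly K[n]}).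

Section Kernel.
Variables (D : idomainType) (f : {rmorphism {mpoly K[n]} -> D}).
Hypothesis If0 : forall p, p \in I -> f p = 0.

Let ker : {pred {ideal_quot I}} := fun q => f (repr q) == 0.

Let ker_pi p : (\pi_({ideal_quot I})%qT p \in ker) = (f p == 0).
Proof.
rewrite unfold_in; have : repr (\pi_({ideal_quot I})%qT p) - p \in I.
  by rewrite Quotient.idealrBE reprK.
by move=> /If0; rewrite rmorphB /= => /eqP; rewrite subr_eq0 => /eqP ->.
Qed.

Lemma quot_ker_prime : exists P : prime_idealr {ideal_quot I},
  forall p, (\pi_({ideal_quot I})%qT p \in P) = (f p == 0).
Proof.
have kerI : idealr_closed ker.
  split.
  - by have := ker_pi 0; rewrite rmorph0 rmorph0 eqxx.
  - by have := ker_pi 1; rewrite rmorph1 rmorph1 oner_eq0 => ->.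
  - move=> a u v; rewrite -[a]reprK -[u]reprK -[v]reprK.
    rewrite -rmorphM -rmorphD !ker_pi rmorphD rmorphM /=.
    by move=> /eqP -> /eqP ->; rewrite mulr0 addr0.
have kerP : prime_idealr_closed ker.
  move=> u v; rewrite -[u]reprK -[v]reprK -rmorphM !ker_pi rmorphM /=.
  by rewrite mulf_eq0.
pose iI := isIdealr.Build _ _ kerI.
pose iP := isPrimeIdealrClosed.Build _ _ kerP.
pose P : prime_idealr {ideal_quot I} := HB.pack ker iI iP.
by exists P => p; exact: ker_pi.
Qed.

End Kernel.

Let ev (h : 'I_n -> {mpoly K[n]}) : {rmorphism {mpoly K[n]} -> {mpoly K[n]}} :=
  mmap (@mpolyC n K) h.

Let evX h m : ev h 'X_[m] = mmap1 h m. Proof. exact: mmapX. Qed.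

Let evX1 h i : ev h 'X_i = h i. Proof. by rewrite evX mmap1U. Qed.

Let evZ h c p : ev h (c *: p) = c%:MP * ev h p. Proof. exact: mmapZ. Qed.

Let evC h c : ev h c%:MP = c%:MP. Proof. exact: mmapC. Qed.

Lemma pure_power_ex : monomial_ideal I -> krull_dim {ideal_quot I} 0 ->
  forall i : 'I_n, exists k, (0 < k)%N && ('X_i ^+ k \in I).
Proof.
move=> [A genA] [_ dim0] i; apply: contrapT => nopow.
have AI m : A m -> 'X_[m] \in I.
  move=> Am; rewrite genA; apply/asboolP.
  exists [:: (1, 'X_[m])]; split; last by rewrite big_seq1 mul1r.
  by move=> x; rewrite inE => /eqP ->; exists m.
have noti m : A m -> exists2 j, j != i & (0 < m j)%N.
  move=> Am; apply: contrapT => none.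
  have mE : m = (U_(i) *+ m i)%MM.
    apply/mnmP => j; rewrite mulmnE mnm1E.
    case: eqVneq => [<-|ne_ij]; first by rewrite mul1n.
    rewrite mul0n; apply/eqP; rewrite -leqn0 leqNgt; apply/negP => mj.
    by apply: none; exists j => //; rewrite eq_sym.
  have := AI _ Am; rewrite mE -mpolyXn => XI.
  apply: nopow; exists (m i); rewrite XI andbT lt0n; apply/eqP => m0.
  by move: XI; rewrite m0 expr0 idealr1.
have kill (h : 'I_n -> {mpoly K[n]}) : (forall j, j != i -> h j = 0) ->
    forall p, p \in I -> ev h p = 0.
  move=> h0 p; rewrite genA => /asboolP[s [sA ->]].
  rewrite rmorph_sum big_seq big1 //= => x xs; have [m Am ->] := sA _ xs.
  rewrite rmorphM evX; have [j ne_ji mj] := noti _ Am.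
  rewrite /mmap1 (bigD1 j) //= h0 // expr0n -[_ == _]negbK -lt0n mj.
  by rewrite !(mul0r, mulr0).
pose h1 (j : 'I_n) : {mpoly K[n]} := if j == i then 'X_i else 0.
have h1P j : j != i -> h1 j = 0 by rewrite /h1 => /negPf ->.
have [P1 P1E] := @quot_ker_prime _ (ev h1) (kill h1 h1P).
have [P0 P0E] := @quot_ker_prime _ (ev (fun=> 0))
  (kill (fun=> 0) (fun _ _ => erefl)).
suff : (1 <= 0)%N by [].
apply: (dim0 _ (fun k => if k is 0%N then P1 else P0)) => -[|//] _; split.
  move=> q; rewrite -[q]reprK P1E P0E.
  move=> /eqP/(congr1 (ev (fun=> 0))).
  rewrite rmorph0 => /eqP; congr (_ == _).
  elim/mpolyind: (repr q) => [|c m p _ _ IHp]; first by rewrite !rmorph0.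
  rewrite !rmorphD IHp; congr (_ + _); rewrite !evZ rmorphM evC !evX.
  congr (_ * _); rewrite /mmap1 rmorph_prod; apply: eq_bigr => j _.
  rewrite rmorphXn /h1; case: eqP => _; last by rewrite rmorph0.
  by rewrite evX1.
move=> sub; have := sub (\pi_({ideal_quot I})%qT 'X_i).
rewrite P0E P1E !evX1 eqxx /h1 eqxx => /(_ isT)/eqP X0.
have := congr1 (mcoeff U_(i)) X0; rewrite mcoeffX eqxx mcoeff0.
by move/eqP; rewrite oner_eq0.
Qed.

(* The exponent b_i: the least k >= 1 such that x_i^k lies in I. *)
Definition pure_exp (monI : monomial_ideal I)
  (dimI : krull_dim {ideal_quot I} 0) (i : 'I_n) : nat :=
  ex_minn (pure_power_ex monI dimI i).

End PurePowers.

Section Polarization.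
Variables (K : fieldType) (n : nat) (b : 'I_n -> nat).

(* The variables x_{i,j} with 1 <= j <= b_i; the second component of the
   dependent pair is j - 1. *)
Definition pvar : finType := {i : 'I_n & 'I_(b i)}.

Definition pvar1 (x : pvar) : 'I_n := tag x.
Definition pvar2 (x : pvar) : nat := (tagged x).+1.

Definition pring : comNzRingType := {mpoly K[#|pvar|]}.

Definition pX (x : pvar) : pring := 'X_(enum_rank x).

(* Meaningful when v i <= b i for all i, in particular for v in G(I). *)
Definition polar_mon (v : 'X_{1..n}) : pring :=
  \prod_(x : pvar | (pvar2 x <= v (pvar1 x))%N) pX x.

Variable I : {pred {mpoly K[n]}}.

Definition polar_ideal : {pred pring} :=
  ideal_gen (fun q => exists2 v, mon_gens I v & q = polar_mon v).

Definition polar_complex : {set {set pvar}} :=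
  [set F : {set pvar} | \prod_(x in F) pX x \notin polar_ideal].

End Polarization.

Definition facet (V : finType) (D : {set {set V}}) (F : {set V}) : bool :=
  maxset (fun G => G \in D) F.

(* Main.v *)
Require Import Defs.
From mathcomp Require Import all_boot all_order all_algebra ring_quotient.
From mathcomp Require Import mpoly.
From mathcomp Require Import boolp.

(** A set [G] of variables is a face iff it contains no [v^p] with [v] in
    [G(I)]. If [G] is a face, then for each [i] some [x_{i,j}] is missing from
    [G], because [x_i^{b_i}] lies in [I]; taking the least such [j] as
    [a_i + 1] puts [G] inside the complement [F_a] of the [x_{i,a_i+1}] and
    keeps [x^a] out of [I]. Conversely [F_a] is a face whenever [x^a] is not in
    [I], and [F_a] determines [a], so no two of the [F_a] are comparable. *)

Import GRing.Theory.
Local Open Scope ring_scope.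

(** Some term [x.1 * x.2] of the sum has a nonzero coefficient at [m], so its monomial factor
    divides ['X_[m]]. The index type [T] lets this serve both $G(I)$ and the polarized
    generators. *)
Lemma mpolyX_in_ideal_gen {K : fieldType} {n : nat} {T : Type}
    {A : T -> Prop} {f : T -> {mpoly K[n]}} {e : T -> 'X_{1..n}}
    (fE : forall t, f t = 'X_[e t]) (m : 'X_{1..n}) :
  ('X_[m] \in ideal_gen (fun q => exists2 t, A t & q = f t)) <->
  exists2 t, A t & (e t <= m)%MM.
Proof.
split=> [/asboolP[s [sA eqm]]|[t At le_tm]]; last first.
  apply/asboolP; exists [:: ('X_[m - e t], f t)]; split.
    by move=> x; rewrite inE => /eqP ->; exists t.
  by rewrite big_seq1 /= fE -mpolyXD submK.
have : ('X_[m] : {mpoly K[n]})@_m != 0 by rewrite mcoeffX eqxx oner_neq0.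
rewrite eqm raddf_sum /= => nz.
have [x xs xm] : exists2 x, x \in s & (x.1 * x.2)@_m != 0.
  apply: contrapT => none; move/negP: nz; apply; apply/eqP.
  rewrite big_seq big1 // => x xs; apply/eqP; apply: contrapT => /negP xm.
  by apply: none; exists x.
have [t At xE] := sA _ xs; exists t => //; move: xm.
rewrite xE fE -mcoeff_msupp (perm_mem (msuppMX _ _)) => /mapP[m' _ ->].
by apply/mnm_lepP => i; rewrite mnmDE leq_addr.
Qed.

Lemma mpolyX_in_mon_gens {K : fieldType} {n : nat} {I : idealr {mpoly K[n]}}
    (monI : monomial_ideal I) (m : 'X_{1..n}) :
  'X_[m] \in I <-> exists2 v, mon_gens I v & (v <= m)%MM.
Proof.
have [A minA] := min_mon_generates_ex monI.
rewrite minA.1 (mpolyX_in_ideal_gen (e := id)) //.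
split=> [[v Av le_vm]|[v [B minB Bv] le_vm]]; exists v => //; first by exists A.
exact/(min_mon_generates_uniq minB minA).
Qed.

Lemma mpolyX_in_le {K : fieldType} {n : nat} {I : idealr {mpoly K[n]}}
    {k m : 'X_{1..n}} : (k <= m)%MM -> 'X_[k] \in I -> 'X_[m] \in I.
Proof. by move=> /submK <-; rewrite mpolyXD; exact: idealMr. Qed.

Section PolarComplex.
Context {K : fieldType} {n : nat} {b : 'I_n -> nat}.

Let mnm_of (F : {set pvar b}) : 'X_{1..#|pvar b|} :=
  (\sum_(x in F) U_(enum_rank x))%MM.

Let mnm_ofE F x : mnm_of F (enum_rank x) = (x \in F).
Proof.
rewrite mnm_sumE; under eq_bigr do rewrite mnm1E (inj_eq enum_rank_inj).
have [xF|xF] := boolP (x \in F).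
  by rewrite (bigD1 x) //= eqxx big1 // => y /andP[_ /negPf ->].
by rewrite big1 // => y yF; apply/eqP; rewrite eqb0; apply: contraNneq xF => <-.
Qed.

Let mnm_of_le F G : (mnm_of F <= mnm_of G)%MM = (F \subset G).
Proof.
apply/mnm_lepP/subsetP => FG x.
  by move=> xF; move: (FG (enum_rank x)); rewrite !mnm_ofE xF; case: (x \in G).
rewrite -[x]enum_valK !mnm_ofE.
by have := FG (enum_val x); case: (_ \in F) => // ->.
Qed.

Let prod_pX (F : {set pvar b}) : \prod_(x in F) pX K x = 'X_[mnm_of F].
Proof. by apply/esym/big_morph; [exact: mpolyXD | exact: mpolyX0]. Qed.

(** The monomial of [G] and every $v^\wp$ are squarefree, so divisibility between them is inclusion
    of their sets of variables. *)
Lemma polar_complexP (I : {pred {mpoly K[n]}}) (G : {set pvar b}) :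
  reflect (forall v, mon_gens I v ->
             exists2 x, x \notin G & (pvar2 x <= v (pvar1 x))%N)
          (G \in polar_complex b I).
Proof.
pose supp (v : 'X_{1..n}) := [set x : pvar b | (pvar2 x <= v (pvar1 x))%N].
have polE v : polar_mon K b v = 'X_[mnm_of (supp v)].
  by rewrite -prod_pX; apply: eq_bigl => x; rewrite inE.
rewrite inE prod_pX; apply: (iffP negP) => [Gface v Iv|out].
  apply: contrapT => none; apply: Gface; apply/(mpolyX_in_ideal_gen polE).
  exists v => //; rewrite mnm_of_le; apply/subsetP => x; rewrite inE => xv.
  by apply: contrapT => /negP xG; apply: none; exists x.
move=> /(mpolyX_in_ideal_gen polE)[v /out[x xG xv]].
by rewrite mnm_of_le => /subsetP/(_ x); rewrite inE (negPf xG) => /(_ xv).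
Qed.

End PolarComplex.

Section Facets.
Context {K : fieldType} {n : nat} {I : idealr {mpoly K[n]}}.
Context {monI : monomial_ideal I} {dimI : krull_dim {ideal_quot I} 0}.

Let b := pure_exp monI dimI.
Let D := polar_complex b I.
(** For each $i$ this holds $x_{i,a_i+1}$ if $a_i < b_i$ and nothing otherwise; [notin_lt_pure_exp]
    gives $a_i < b_i$ when $x^a \notin I$. *)
Let cofacet (a : 'X_{1..n}) : {set pvar b} :=
  [set x | pvar2 x == (a (pvar1 x)).+1].

Lemma pure_exp_in i : 'X_[U_(i) *+ b i] \in I.
Proof.
by rewrite -mpolyXn /b /pure_exp; case: ex_minnP => k /andP[].
Qed.

Lemma notin_lt_pure_exp {a : 'X_{1..n}} i : 'X_[a] \notin I -> (a i < b i)%N.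
Proof.
apply: contraNT; rewrite -leqNgt => le_ba.
apply: mpolyX_in_le (pure_exp_in i); apply/mnm_lepP => j.
by rewrite mulmnE mnm1E; case: eqVneq => [<-|_]; rewrite ?mul1n.
Qed.

(** No $v \in G(I)$ divides $x^a$, so $a_i < v_i$ for some $i$; then $x_{i,a_i+1}$ divides $v^\wp$
    but was removed. *)
Lemma setC_cofacet_face (a : 'X_{1..n}) : 'X_[a] \notin I -> ~: cofacet a \in D.
Proof.
move=> aI; apply/polar_complexP => v Iv.
have [i lt_av] : exists i, (a i < v i)%N.
  apply: contrapT => none; move/negP: aI; apply; apply/mpolyX_in_mon_gens => //.
  exists v => //; apply/mnm_lepP => i; rewrite leqNgt; apply/negP => lt_av.
  by apply: none; exists i.
exists (Tagged (fun i => 'I_(b i)) (Ordinal (notin_lt_pure_exp i aI))) => //.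
by rewrite !inE negbK /pvar1 /pvar2.
Qed.

Lemma face_sub_setC_cofacet {G : {set pvar b}} :
  G \in D -> exists2 a : 'X_{1..n}, 'X_[a] \notin I & G \subset ~: cofacet a.
Proof.
move=> /polar_complexP Gface.
(* Here [j] counts from zero: the variable absent from [G] is $x_{i,j+1}$. *)
pose missing i j :=
  [exists k : 'I_(b i), (k == j :> nat) && (Tagged _ k \notin G)].
have missing_ex i : exists j, missing i j.
  (* A generator dividing $x_i^{b_i}$ involves only $x_i$, so the variable of its polarization
     missing from [G] has first index $i$. *)
  have /mpolyX_in_mon_gens[//|v Iv /mnm_lepP le_v] := pure_exp_in i.
  have [[j k] xG] := Gface v Iv; rewrite /pvar1 /pvar2 /= => lt_kv.
  have := leq_trans lt_kv (le_v j); rewrite mulmnE mnm1E.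
  case: eqVneq => [eq_ij|]; last by rewrite mul0n.
  move=> _; exists k; subst j.
  by apply/existsP; exists k; rewrite eqxx.
pose a := [multinom ex_minn (missing_ex i) | i < n].
have aP i : missing i (a i) /\ forall j, missing i j -> (a i <= j)%N.
  by rewrite mnmE; case: ex_minnP.
exists a.
  (* If $v$ divided $x^a$, a variable $x_{i,k+1}$ of $v^\wp$ missing from [G] would have $k < v_i
     \le a_i$, against the minimality of $a_i$. *)
  apply/negP => /(mpolyX_in_mon_gens monI)[v Iv /mnm_lepP le_va].
  have [[i k] xG] := Gface v Iv; rewrite /pvar1 /pvar2 /= => lt_kv.
  suff : (a i <= k)%N by rewrite leqNgt (leq_trans lt_kv).
  by apply: (aP i).2; apply/existsP; exists k; rewrite eqxx.
apply/subsetP => -[i k] xG; rewrite !inE /pvar1 /pvar2 /= eqSS.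
apply: contraTneq xG => eq_ka; have [/existsP[k' /andP[/eqP eq_k' xG]] _] := aP i.
by have -> : k = k' by apply: val_inj; rewrite /= eq_k'.
Qed.

(** Since $a_i < b_i$, the variable $x_{i,a_i+1}$ exists; the only candidate with first index $i$ in
    [cofacet a'] is $x_{i,a'_i+1}$. *)
Lemma cofacet_sub_inj {a a' : 'X_{1..n}} :
  'X_[a] \notin I -> cofacet a \subset cofacet a' -> a = a'.
Proof.
move=> aI /subsetP sub; apply/mnmP => i.
have := sub (Tagged (fun i => 'I_(b i)) (Ordinal (notin_lt_pure_exp i aI))).
by rewrite !inE /pvar1 /pvar2 /= eqxx => /(_ isT)/eqP[].
Qed.

End Facets.

Theorem corollary1p2 (K : fieldType) (n : nat) (I : idealr {mpoly K[n]})
    (monI : monomial_ideal I) (dimI : krull_dim {ideal_quot I} 0)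
    (F : {set pvar (pure_exp monI dimI)}) :
  facet (polar_complex (pure_exp monI dimI) I) F <->
  exists a : 'X_{1..n},
    'X_[a] \notin I /\
    F = ~: [set x : pvar (pure_exp monI dimI) | pvar2 x == (a (pvar1 x)).+1].
Proof.
split=> [/maxsetP[Fface Fmax]|[a [aI ->]]].
  have [a aI subF] := face_sub_setC_cofacet Fface; exists a; split=> //.
  by rewrite (Fmax _ _ subF) //; exact: setC_cofacet_face.
apply/maxsetP; split=> [|G Gface subG]; first exact: setC_cofacet_face.
(* A face above $F_a$ lies in some $F_{a'}$; complementing gives $a' = a$, so the chain of
   inclusions collapses. *)
have [a' a'I subG'] := face_sub_setC_cofacet Gface.
have := subset_trans subG subG'; rewrite setCS => /(cofacet_sub_inj a'I) eq_a.
by apply/eqP; rewrite eqEsubset subG andbT -eq_a.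
Qed.
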